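(* For every graph $G$ and every $r\in\mathbb{N}$, $\operatorname{copwidth}_r(G)\le\operatorname{sw}_{2r}(G)+1$. Moreover, there is an enumeration $v_1,\dots,v_n$ of $V(G)$ such that $\operatorname{sw}_{2r}(G)+1$ cops have a winning strategy in the Cops and Robber game of radius $r$ on $G$ in which, in every round $i$, the cops occupy only vertices among $v_1,\dots,v_i$, and (as long as he is not caught) the robber's position after round $i$ lies among $v_{i+1},\dots,v_n$; in particular the robber never visits a vertex previously occupied by a cop.
   Context: Graphs are finite, simple, undirected. Cops and Robber game of radius $r$ and width $k$ on $G$: the robber picks $w_0\in V(G)$ and $C_0=\emptyset$. In each round $i=1,2,\dots$, the cops announce a set $C_i\subseteq V(G)$ with $|C_i|\le k$; then the robber moves from $w_{i-1}$ along a path of length at most $r$ avoiding $C_i\cap C_{i-1}$ to a new position $w_i$, and the cops are placed on $C_i$; the cops win if $w_i\in C_i$. $\operatorname{copwidth}_r(G)$ is the least $k$ such that the cops have a winning strategy in the game of radius $r$ and width $k$. For $S\subseteq V(G)$ and $v\in V(G)\setminus S$, $\operatorname{sep}_r(v/S)$ is the set of vertices of $S$ reachable from $v$ by a path of length at most $r$ whose inner vertices are not in $S$; $\operatorname{sw}_r(G)$ is the least $k$ such that there is a total order $\le$ on $V(G)$ with $|\operatorname{sep}_r(v/S)|\le k$ for every $\le$-downward closed $S\subseteq V(G)$ and every $v\in V(G)\setminus S$. *)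

(* Defs.v *)
From HB Require Import structures.
From mathcomp Require Import all_boot.
From mathcomp Require Import boolp.

Set Implicit Arguments.
Unset Strict Implicit.
Unset Printing Implicit Defensive.

Record sgraph := SGraph {
  vertex :> finType;
  edge : rel vertex;
  edge_sym : symmetric edge;
  edge_irrefl : irreflexive edge }.

(* The path is x :: p, so its length (number of edges) is size p. *)
Definition is_path (G : sgraph) (x y : G) (p : seq G) : bool :=
  [&& path (@edge G) x p, uniq (x :: p) & last x p == y].

Definition inner (T : Type) (x : T) (p : seq T) : seq T := behead (belast x p).

Definition sep (G : sgraph) (r : nat) (v : G) (S : {set G}) : {set G} :=
  [set u in S | [exists n : 'I_r.+1, [exists p : n.-tuple G,
     is_path v u p && all (fun x => x \notin S) (inner v p)]]].

Definition total_order (T : eqType) (le : rel T) : Prop :=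
  [/\ total le, antisymmetric le & transitive le].

Definition down_closed (T : finType) (le : rel T) (S : {set T}) : Prop :=
  forall x y, le x y -> y \in S -> x \in S.

Definition sw_bounded (G : sgraph) (r k : nat) : Prop :=
  exists2 le : rel G, total_order le &
    forall S : {set G}, down_closed le S ->
    forall v : G, v \notin S -> #|sep r v S| <= k.

(* The announcement C_i is computed from the robber's past positions
   [:: w_0; ..; w_(i-1)]; the cops' own past moves are determined by these. *)
Definition strategy (G : sgraph) := seq G -> {set G}.

Definition cops (G : sgraph) (s : strategy G) (w : nat -> G) (i : nat) :
    {set G} :=
  if i is 0 then set0 else s (mkseq w i).

(* No capture in rounds 1, .., i - 1, so that round i takes place. At j = 0
   the condition is void, as cops s w 0 = set0. *)
Definition uncaught_before (G : sgraph) (s : strategy G) (w : nat -> G)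
    (i : nat) : Prop :=
  forall j, j < i -> w j \notin cops s w j.

Definition robber_move (G : sgraph) (r : nat) (A : {set G}) (x y : G)
    (p : seq G) : bool :=
  [&& is_path x y p, size p <= r & all (fun z => z \notin A) (x :: p)].

(* w i is the robber's position after round i, and w i.-1 :: q i is the path
   used in round i. Once the robber is caught the game is over and the
   remaining values of w and q are irrelevant, hence unconstrained. *)
Definition is_play (G : sgraph) (r : nat) (s : strategy G)
    (w : nat -> G) (q : nat -> seq G) : Prop :=
  forall i, 0 < i -> uncaught_before s w i ->
    robber_move r (cops s w i :&: cops s w i.-1) (w i.-1) (w i) (q i).

Definition winning (G : sgraph) (r k : nat) (s : strategy G) : Prop :=
  (forall h, #|s h| <= k) /\
  forall w q, is_play r s w q -> exists2 i, 0 < i & w i \in cops s w i.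

Definition cops_win (G : sgraph) (r k : nat) : Prop :=
  exists s : strategy G, winning r k s.

Lemma sw_exists (G : sgraph) (r : nat) : exists k, `[< sw_bounded G r k >].
Proof.
exists #|G|; apply/asboolP.
exists (fun x y => enum_rank x <= enum_rank y); last by move=> *; apply: max_card.
split=> [x y|x y|y x z]; first exact: leq_total.
- by move/anti_leq/val_inj/enum_rank_inj.
- exact: leq_trans.
Qed.

Lemma copwidth_exists (G : sgraph) (r : nat) : exists k, `[< cops_win G r k >].
Proof.
exists #|G|; apply/asboolP; exists (fun=> setT); split=> [h|w q _].
  exact: max_card.
by exists 1; rewrite //= inE.
Qed.

Definition sw (r : nat) (G : sgraph) : nat := ex_minn (sw_exists G r).

Definition copwidth (r : nat) (G : sgraph) : nat := ex_minn (copwidth_exists G r).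

Definition is_enumeration (T : finType) (v : seq T) : Prop :=
  uniq v /\ forall x, x \in v.

(* Main.v *)
Require Import Defs.
From HB Require Import structures.
From mathcomp Require Import all_boot.
From mathcomp Require Import boolp.

(** Let [v_1, .., v_n] be ordered by an order witnessing [sw (2 * r) G], and
    let [S_i] be the set of its first [i] vertices. In round [i] the cops play
    [v_i] together with [sep_(2r)(w_(i-1) / S_(i-1))]. By induction the robber
    never meets [S_(i-1)] in round [i]: the first vertex [u] of [S_(i-1)] on
    his path lies in the new cop set, and it also lies in the previous one,
    because either [u = v_(i-1)], or the previous path followed by the current
    one up to [u] is a walk of length at most [2 * r] from [w_(i-2)] that meets
    [S_(i-2)] only in [u]. Hence he may not pass through [u]. He thus stays
    outside [S_i] until caught, which happens by round [n]. *)

Set Implicit Arguments.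
Unset Strict Implicit.
Unset Printing Implicit Defensive.

(** A walk is enough: shortening it to a path adds no vertices, and [u], the only vertex of the walk
    in [S], ends the path and so cannot be an inner vertex. *)
Lemma sep_walk (G : sgraph) (r : nat) (v u : G) (S : {set G}) (p : seq G) :
  path (@edge G) v p -> last v p = u -> size p <= r -> u \in S -> v \notin S ->
  {in p, forall x, x \in S -> x = u} -> u \in sep r v S.
Proof.
move=> + + + uS vS; case/shortenP=> p' vp' up' sub p'u pr pS.
have sp : size p' < r.+1.
  rewrite ltnS (leq_trans _ pr) // uniq_leq_size //.
  by move: up' => /= /andP[].
rewrite inE uS /=; apply/existsP.
exists (Ordinal sp); apply/existsP; exists (in_tuple p') => /=.
rewrite /is_path vp' up' p'u eqxx /=; apply/allP => x /mem_behead xp.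
apply: contraL up' => xS; rewrite lastI p'u rcons_uniq negb_and negbK.
have := mem_belast xp; rewrite inE => /orP[/eqP xv|xp'].
  by rewrite xv (negbTE vS) in xS.
by rewrite -(pS x) ?sub ?xp.
Qed.

Lemma total_order_rank (T : finType) (le : rel T) : total_order le ->
  exists v : seq T,
    is_enumeration v /\ {homo index^~ v : x y / le x y >-> x <= y}.
Proof.
case=> tot anti tr; exists (sort le (enum T)); split.
  by split=> [|x]; rewrite ?sort_uniq ?enum_uniq // mem_sort mem_enum.
move=> x y xy; rewrite leqNgt; apply/negP => yx.
have refl : reflexive le by move=> z; case/orP: (tot z z).
have mem z : z \in sort le (enum T) by rewrite mem_sort mem_enum.
suff yx' : le y x by rewrite (anti x y) ?xy ?yx' // ltnn in yx.
have := sorted_leq_index tr refl (sort_sorted tot (enum T)).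
by apply; rewrite ?mem // ltnW.
Qed.

Section SepStrategy.

Variables (G : sgraph) (r k : nat) (v : seq G).
Hypothesis v_enum : is_enumeration v.

Definition initial (i : nat) : {set G} := [set x | index x v < i].

Hypothesis sep_le : forall i x,
  x \notin initial i -> #|sep (2 * r) x (initial i)| <= k.

(** Announcement for round [i.+1], since indices in [v] start at 0. The branch [set0] keeps the
    bound on the size valid for arbitrary histories: [sep_le] speaks only of [x] outside
    [initial i]. *)
Definition sep_move (i : nat) (x : G) : {set G} :=
  if x \in initial i then set0
  else [set y | index y v == i] :|: sep (2 * r) x (initial i).

Definition sep_strategy : strategy G :=
  fun h => if h is x :: h' then sep_move (size h') (last x h') else set0.

Lemma initialE i x : (x \in initial i) = (x \in take i v).
Proof. by rewrite inE in_take ?(proj2 v_enum). Qed.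

Lemma notin_initial i x : (x \notin initial i) = (x \in drop i v).
Proof.
have [uv /(_ x) xv] := v_enum; rewrite initialE.
move: uv xv; rewrite -{1 2}(cat_take_drop i v) cat_uniq mem_cat.
move=> /and3P[_ /hasPn nt _]; have [/nt nx _|_] := boolP (x \in drop i v).
  exact: nx.
by rewrite orbF => ->.
Qed.

Lemma initial_mono i j : i <= j -> initial i \subset initial j.
Proof.
by move=> ij; apply/subsetP => x; rewrite !inE => /leq_trans; apply.
Qed.

Lemma cops_sepS w i : cops sep_strategy w i.+1 = sep_move i (w i).
Proof.
rewrite /cops /sep_strategy /mkseq /= size_map size_iota; congr sep_move.
by rewrite last_map -nth_last size_iota; case: i => // i; rewrite nth_iota.
Qed.

Lemma sep_move_sub i x : sep_move i x \subset initial i.+1.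
Proof.
rewrite /sep_move; case: ifP => _; first exact: sub0set.
apply/subsetP => y; rewrite !inE => /orP[/eqP->//|/andP[+ _]].
exact: ltnW.
Qed.

Lemma cops_sep_sub w i : cops sep_strategy w i \subset initial i.
Proof. by case: i => [|i]; rewrite ?sub0set ?cops_sepS ?sep_move_sub. Qed.

Lemma card_sep_move i x : #|sep_move i x| <= k + 1.
Proof.
rewrite /sep_move; case: ifPn => [_|xi]; first by rewrite cards0.
rewrite (leq_trans (leq_card_setU _ _)) // addnC leq_add ?sep_le //.
apply/card_le1P => y; rewrite inE => /eqP <- z; rewrite !inE.
apply/eqP/eqP => [|->//].
by apply: (@index_inj _ y); rewrite (proj2 v_enum).
Qed.

(** The vertex of index [i] is the only one that [initial i.+1] adds to [initial i], and a cop is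
    placed on it. *)
Lemma sep_strategy_escape w i : w i \notin initial i ->
  w i.+1 \notin initial i -> w i.+1 \notin cops sep_strategy w i.+1 ->
  w i.+1 \notin initial i.+1.
Proof.
rewrite cops_sepS /sep_move => /negbTE ->; rewrite !inE negb_or -!leqNgt.
by move=> le_i /andP[ne_i _]; rewrite ltn_neqAle eq_sym ne_i.
Qed.

Lemma sep_strategy_avoid w q i : is_play r sep_strategy w q ->
  uncaught_before sep_strategy w i.+1 ->
  {in w i :: q i.+1, forall x, x \notin initial i}.
Proof.
move=> play; elim: i => [|i IHi] unc; first by move=> x _; rewrite inE.
have unc' : uncaught_before sep_strategy w i.+1.
  by move=> j ji; apply: unc; apply: ltnW.
have {}IHi := IHi unc'.
have wi : w i \notin initial i by apply: IHi; rewrite mem_head.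
have /and3P[/and3P[pi _ /eqP li] si _] := play i.+1 isT unc'.
have wi1 : w i.+1 \notin initial i.+1.
  apply: sep_strategy_escape => //; last exact: unc.
  by apply: IHi; rewrite -li mem_last.
have /and3P[/and3P[pi1 _ _] si1 av] := play i.+2 isT unc.
suff nS : ~~ has (mem (initial i.+1)) (q i.+2).
  by move=> x; rewrite inE => /orP[/eqP->//|]; apply/hasPn.
apply/negP => hasS.
(* Here [u] is the first vertex of the path in [initial i.+1]; the aim is that it lies in both cop
   sets, so the robber could not have used it. *)
case: (split_find hasS) pi1 si1 av => u p1 p2 uS np1.
rewrite cat_path size_cat size_rcons => /andP[pu _] su.
move=> /allP/(_ u); rewrite inE mem_cat mem_rcons mem_head orbT.
move=> /(_ isT)/negP; apply.
have p1S x : x \in p1 -> x \notin initial i.+1 by apply/hasPn.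
have su' : (size p1).+1 <= r by apply: leq_trans su; apply: leq_addr.
rewrite !cops_sepS in_setI /sep_move (negbTE wi) (negbTE wi1) !in_setU.
apply/andP; split; apply/orP.
  right; apply: (sep_walk pu) => //; rewrite ?last_rcons ?size_rcons //.
    by rewrite (leq_trans su') // leq_pmull.
  by move=> x; rewrite mem_rcons inE => /orP[/eqP//|/p1S/negbTE->].
have [ui|ui] := eqVneq (index u v) i; [by left; rewrite inE ui | right].
have uSi : u \in initial i.
  by move: uS; rewrite /= !inE ltnS leq_eqVlt (negbTE ui).
(* Two rounds of length at most [r] give the radius [2 * r]. The first piece avoids [initial i] by
   induction, the second by the choice of [u]. *)
apply: (@sep_walk _ _ _ _ _ (q i.+1 ++ rcons p1 u)) => //.
- by rewrite cat_path pi li.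
- by rewrite last_cat last_rcons.
- by rewrite size_cat size_rcons mul2n -addnn leq_add.
move=> x; rewrite mem_cat mem_rcons inE => /or3P[xq|/eqP//|/p1S xp] xS.
  by have := IHi x; rewrite inE xq orbT xS => /(_ isT).
by rewrite (subsetP (initial_mono (leqnSn i))) in xp.
Qed.

Lemma sep_strategy_behind w q i : is_play r sep_strategy w q ->
  uncaught_before sep_strategy w i.+1 ->
  w i.+1 \notin cops sep_strategy w i.+1 -> w i.+1 \notin initial i.+1.
Proof.
move=> play unc; have av := sep_strategy_avoid play unc.
have /and3P[/and3P[_ _ /eqP li] _ _] := play i.+1 isT unc.
by apply: sep_strategy_escape; apply: av; rewrite ?mem_head // -li mem_last.
Qed.

Lemma winning_sep_strategy : winning r (k + 1) sep_strategy.
Proof.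
split=> [[|x h]|w q play]; rewrite ?cards0 ?card_sep_move //.
apply: contrapT => free.
have unc i : w i \notin cops sep_strategy w i.
  by case: i => [|i]; rewrite ?inE //; apply/negP => wi; apply: free; exists i.+1.
(* [initial (size v).+1] is the whole vertex set, so no position is left for the robber. *)
have := @sep_strategy_behind w q (size v) play (fun j _ => unc j) (unc _).
by rewrite inE ltnS index_size.
Qed.

End SepStrategy.

Lemma sw_spec (G : sgraph) (r : nat) : sw_bounded G r (sw r G).
Proof. by rewrite /sw; case: ex_minnP => k /asboolP. Qed.

Lemma copwidth_le (G : sgraph) (r k : nat) : cops_win G r k -> copwidth r G <= k.
Proof. by rewrite /copwidth; case: ex_minnP => m _ min /asboolP/min. Qed.

(* With the enumeration v_1, .., v_n given as a sequence v, take i v lists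
   v_1, .., v_i and drop i v lists v_(i+1), .., v_n. *)
Theorem theorem5p3 (G : sgraph) (r : nat) :
  copwidth r G <= sw (2 * r) G + 1 /\
  exists (v : seq G) (s : strategy G),
    [/\ is_enumeration v,
        winning r (sw (2 * r) G + 1) s &
        forall (w : nat -> G) (q : nat -> seq G), is_play r s w q ->
        forall i, 0 < i -> uncaught_before s w i ->
          [/\ forall x, x \in cops s w i -> x \in take i v,
              w i \notin cops s w i -> w i \in drop i v &
              forall j x, j < i -> x \in w i.-1 :: q i -> x \notin cops s w j]].
Proof.
have [le le_tot sep_le] := sw_spec G (2 * r).
have [v [v_enum v_mono]] := total_order_rank le_tot.
have win : winning r (sw (2 * r) G + 1) (sep_strategy r v).
  (* Monotonicity of the index makes each [initial i] downward closed. *)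
  apply: winning_sep_strategy => // i x; apply: sep_le => y z yz.
  by rewrite !inE; apply: leq_ltn_trans; apply: v_mono.
split; first by apply: copwidth_le; exists (sep_strategy r v).
exists v, (sep_strategy r v); split=> // w q play [//|i] _ unc; split.
- by move=> x /(subsetP (cops_sep_sub _ _ _ _)); rewrite initialE.
- by rewrite -notin_initial //; apply: sep_strategy_behind play unc.
(* All earlier cop sets lie in the initial segment that the current path avoids. *)
move=> j x ji /(sep_strategy_avoid play unc).
by apply/contra/subsetP/(subset_trans (cops_sep_sub _ _ _ _))/initial_mono.
Qed.
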